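(* Let $N=8n$ with $n\geq 1$ an integer. Let $x=(1\;2)(3\;4)\cdots(4n-1\;4n)\in A_N$, and let $\mathcal{Z}_{A_N}(x)$ denote the centralizer of $x$ in $A_N$. Let $y=(1\;4n+1)(2\;4n+2)\cdots(4n\;8n)\in A_N$. Then each element in the coset $y\mathcal{Z}_{A_N}(x)$ is a product of disjoint cycles, each of even length. In particular, each element in the coset $y\mathcal{Z}_{A_N}(x)$ has even order.
   Context: $A_N$ is the alternating group on $[N]=\{1,2,\ldots,N\}$. The permutation $x$ is the product of the $2n$ disjoint transpositions $(2i-1\;\,2i)$, $1\leq i\leq 2n$ (so it fixes $4n+1,\ldots,8n$), and $y$ is the product of the $4n$ disjoint transpositions $(i\;\,4n+i)$, $1\leq i\leq 4n$. Products of permutations are executed from right to left. The disjoint cycle decomposition of a permutation of $[N]$ is understood to include fixed points as cycles of length $1$; thus ''a product of disjoint cycles, each of even length'' means that every cycle in the decomposition has even length (in particular there are no fixed points). *)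

(* Defs.v *)
From mathcomp Require Import all_boot.
From mathcomp Require Import all_fingroup all_solvable.
From mathcomp Require Import zify.

Set Implicit Arguments.
Unset Strict Implicit.
Unset Printing Implicit Defensive.

Import GroupScope.

(* The points 1, ..., 8n are renumbered 0, ..., 8n - 1, as elements of
   'I_(8 * n): the point k becomes the ordinal of value k - 1. *)

Lemma xfst_subproof n (i : 'I_(2 * n)) : (2 * i < 8 * n)%N.
Proof. by have := ltn_ord i; lia. Qed.

Lemma xsnd_subproof n (i : 'I_(2 * n)) : (2 * i + 1 < 8 * n)%N.
Proof. by have := ltn_ord i; lia. Qed.

Lemma yfst_subproof n (i : 'I_(4 * n)) : (i < 8 * n)%N.
Proof. by have := ltn_ord i; lia. Qed.

Lemma ysnd_subproof n (i : 'I_(4 * n)) : (4 * n + i < 8 * n)%N.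
Proof. by have := ltn_ord i; lia. Qed.

Definition xperm (n : nat) : 'S_(8 * n) :=
  \prod_(i < 2 * n)
    tperm (Ordinal (xfst_subproof i)) (Ordinal (xsnd_subproof i)).

Definition yperm (n : nat) : 'S_(8 * n) :=
  \prod_(i < 4 * n)
    tperm (Ordinal (yfst_subproof i)) (Ordinal (ysnd_subproof i)).

Lemma xperm_Alt n : xperm n \in 'Alt_('I_(8 * n)).
Proof.
rewrite Alt_even /xperm (big_morph _ (@odd_permM _) (odd_perm1 _)).
under eq_bigr => i _ do
  rewrite odd_tperm -val_eqE /= addn1 neq_ltn ltnSn /=.
by rewrite big_const_ord; elim: n => // n; rewrite mulnS /= negbK.
Qed.

Lemma yperm_Alt n : yperm n \in 'Alt_('I_(8 * n)).
Proof.
rewrite Alt_even /yperm (big_morph _ (@odd_permM _) (odd_perm1 _)).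
have -> : \big[addb/false]_(i < 4 * n)
    (tperm (Ordinal (yfst_subproof i)) (Ordinal (ysnd_subproof i)) : bool)
  = \big[addb/false]_(i < 4 * n) true.
  apply: eq_bigr => i _; rewrite odd_tperm -val_eqE /=.
  by apply/eqP => /=; have := ltn_ord i; lia.
by rewrite big_const_ord; elim: n => // n; rewrite mulnS /= !negbK.
Qed.

(* The coset y Z(x) for products executed from right to left, that is, the set
   of the functions y \o z with z in the centralizer of x in the alternating
   group. MathComp executes products of permutations from left to right
   (permM : (s * t) i = t (s i)), so y \o z is z * y, and this set is the
   right coset Z(x) :* y of MathComp. *)
Definition yZcoset (n : nat) : {set 'S_(8 * n)} :=
  'C_('Alt_('I_(8 * n)))[xperm n] :* yperm n.

Lemma yZcosetP n (s : 'S_(8 * n)) :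
  reflect (exists2 z, z \in 'C_('Alt_('I_(8 * n)))[xperm n] &
                      s =1 yperm n \o z)
          (s \in yZcoset n).
Proof.
apply: (iffP rcosetP) => -[z zC Es]; exists z => //.
  by move=> i; rewrite Es permM.
by apply/permP => i; rewrite Es permM.
Qed.

(* Main.v *)
Require Import Defs.
From mathcomp Require Import all_boot.
From mathcomp Require Import all_fingroup all_solvable.
From mathcomp Require Import zify.

Set Implicit Arguments.
Unset Strict Implicit.
Unset Printing Implicit Defensive.

Import GroupScope.

(** A permutation commuting with [x] preserves the support [{1, ..., 4n}] of
    [x], whereas [y] exchanges this support with its complement. So every
    element of the coset exchanges the support and its complement, and only its
    even powers can fix a point. *)

Section DisjointTranspositions.

Variables (I : eqType) (T : finType) (f g : I -> T).
Hypotheses (f_inj : injective f) (g_inj : injective g).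
Hypothesis fg_neq : forall i j, f i != g j.

Lemma prod_tperm_out (r : seq I) (a : T) :
  {in r, forall i, (f i != a) && (g i != a)} ->
  (\prod_(i <- r) tperm (f i) (g i)) a = a.
Proof.
elim: r => [|i r IHr] ar; first by rewrite big_nil perm1.
have /andP[fia gia] := ar i (mem_head i r).
rewrite big_cons permM tpermD // IHr // => j jr.
by apply: ar; rewrite inE jr orbT.
Qed.

(** The head of the list acts first. If its index is [i], it sends [f i] to [g i], which the later
    transpositions fix because [r] has no repetition; otherwise it fixes [f i] and the induction
    hypothesis applies. *)
Lemma prod_tperm_l (r : seq I) (i : I) : uniq r -> i \in r ->
  (\prod_(j <- r) tperm (f j) (g j)) (f i) = g i.
Proof.
elim: r => // j r IHr /= /andP[j_r r_uniq]; rewrite inE big_cons permM.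
have [->|ij /= ir] := eqVneq i j; last first.
  by rewrite tpermD ?IHr // ?(inj_eq f_inj) 1?eq_sym.
move=> _; rewrite tpermL prod_tperm_out // => k kr.
by rewrite fg_neq (inj_eq g_inj); apply: contraNneq j_r => <-.
Qed.

Lemma prod_tperm_r (r : seq I) (i : I) : uniq r -> i \in r ->
  (\prod_(j <- r) tperm (f j) (g j)) (g i) = f i.
Proof.
elim: r => // j r IHr /= /andP[j_r r_uniq]; rewrite inE big_cons permM.
have [->|ij /= ir] := eqVneq i j; last first.
  by rewrite tpermD ?IHr // (inj_eq g_inj) eq_sym.
move=> _; rewrite tpermR prod_tperm_out // => k kr.
rewrite (inj_eq f_inj) [g k == _]eq_sym fg_neq andbT.
by apply: contraNneq j_r => <-.
Qed.

End DisjointTranspositions.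

(** This trades an inequality on values for a fixed-point condition, which commutation with
    [xperm n] can transport. *)
Lemma xperm_fixed n (a : 'I_(8 * n)) : (xperm n a == a) = (4 * n <= a)%N.
Proof.
have f_inj : injective (fun i : 'I_(2 * n) => Ordinal (xfst_subproof i)).
  by move=> i j /(congr1 val) /= ?; apply: val_inj => /=; lia.
have g_inj : injective (fun i : 'I_(2 * n) => Ordinal (xsnd_subproof i)).
  by move=> i j /(congr1 val) /= ?; apply: val_inj => /=; lia.
have fg_neq (i j : 'I_(2 * n)) :
    Ordinal (xfst_subproof i) != Ordinal (xsnd_subproof j).
  by rewrite -val_eqE /=; apply/eqP; lia.
have [a_ge|a_lt] := leqP (4 * n) a.
  apply/eqP/prod_tperm_out => i _; rewrite -!val_eqE /=.
  by have := ltn_ord i; lia.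
(* With points numbered from 0, [a] lies in the transposition of index [a./2], as its second entry
   exactly when [a] is odd. *)
have i_lt : (a./2 < 2 * n)%N by lia.
pose i := Ordinal i_lt.
have [a_odd|a_even] := boolP (odd a).
  have -> : a = Ordinal (xsnd_subproof i) by apply: val_inj => /=; lia.
  rewrite /xperm (prod_tperm_r f_inj g_inj fg_neq)
    ?index_enum_uniq ?mem_index_enum //.
  by apply: negbTE; apply: fg_neq.
have -> : a = Ordinal (xfst_subproof i) by apply: val_inj => /=; lia.
rewrite /xperm (prod_tperm_l f_inj g_inj fg_neq)
  ?index_enum_uniq ?mem_index_enum //.
by rewrite eq_sym; apply: negbTE; apply: fg_neq.
Qed.

Lemma yperm_ge n (a : 'I_(8 * n)) : (4 * n <= yperm n a)%N = (a < 4 * n)%N.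
Proof.
have f_inj : injective (fun i : 'I_(4 * n) => Ordinal (yfst_subproof i)).
  by move=> i j /(congr1 val) /= ?; apply: val_inj => /=; lia.
have g_inj : injective (fun i : 'I_(4 * n) => Ordinal (ysnd_subproof i)).
  by move=> i j /(congr1 val) /= ?; apply: val_inj => /=; lia.
have fg_neq (i j : 'I_(4 * n)) :
    Ordinal (yfst_subproof i) != Ordinal (ysnd_subproof j).
  by rewrite -val_eqE /=; apply/eqP; have := ltn_ord i; lia.
have [a_lt|a_ge] := ltnP a (4 * n).
  have -> : a = Ordinal (yfst_subproof (Ordinal a_lt)) by apply: val_inj.
  rewrite /yperm (prod_tperm_l f_inj g_inj fg_neq)
    ?index_enum_uniq ?mem_index_enum //=.
  by rewrite leq_addr.
have i_lt : (a - 4 * n < 4 * n)%N by have := ltn_ord a; lia.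
have -> : a = Ordinal (ysnd_subproof (Ordinal i_lt)).
  by apply: val_inj => /=; lia.
rewrite /yperm (prod_tperm_r f_inj g_inj fg_neq)
  ?index_enum_uniq ?mem_index_enum //=.
by apply/negbTE; rewrite -ltnNge.
Qed.

(** Commutation gives [x (z a) = z (x a)], and [z] is injective. *)
Lemma fixed_commute (T : finType) (x z : {perm T}) (a : T) :
  commute x z -> (x (z a) == z a) = (x a == a).
Proof. by move=> xz; rewrite -permM -xz permM (inj_eq perm_inj). Qed.

Section ExchangedParts.

Variables (T : finType) (s : {perm T}) (P : pred T).
Hypothesis sP : forall a, P (s a) = ~~ P a.

(** Each application of [s] flips [P], so a return to [a] takes an even number of flips. *)
Lemma iter_exchange_odd k a : iter k s a = a -> ~~ odd k.
Proof.
have Pk : P (iter k s a) = P a (+) odd k.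
  by elim: k => [|k IHk] /=; rewrite ?addbF // sP IHk addbN.
by move=> ka; move: Pk; rewrite ka; case: (P a) (odd k) => -[].
Qed.

Lemma porbit_exchange_odd c : c \in porbits s -> ~~ odd #|c|.
Proof. by case/imsetP=> a _ ->; apply: iter_exchange_odd (iter_porbit s a). Qed.

(** The point [a] excludes the empty type, where [sP] holds vacuously and [s] is the identity, of
    order 1. *)
Lemma order_exchange_odd (a : T) : ~~ odd #[s].
Proof.
by apply: (@iter_exchange_odd _ a); rewrite -permX expg_order perm1.
Qed.

End ExchangedParts.

Theorem theorem1p4 (n : nat) (n_ge1 : (1 <= n)%N) (s : 'S_(8 * n))
    (s_yZ : s \in yZcoset n) :
  (forall c : {set 'I_(8 * n)}, c \in porbits s -> ~~ odd #|c|)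
  /\ ~~ odd #[s].
Proof.
have [z /setIP[_ /cent1P xz] sE] := yZcosetP s s_yZ.
have sP (a : 'I_(8 * n)) : (4 * n <= s a)%N = ~~ (4 * n <= a)%N.
  (* Since [s a] is [yperm n (z a)], it lies in the upper half exactly when [z a] is moved by
     [xperm n], that is, when [a] is. *)
  by rewrite sE /= yperm_ge ltnNge -!xperm_fixed fixed_commute.
have n8_gt0 : (0 < 8 * n)%N by rewrite muln_gt0.
split; first by move=> c; apply: porbit_exchange_odd sP c.
exact: order_exchange_odd sP (Ordinal n8_gt0).
Qed.
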